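(* Let $d\ge 3$, $n\ge d+3$, and let $f:[1,\infty)^2\to\mathbb{R}$ be a symmetric function, $f(x,y)=f(y,x)$, satisfying: (i) $f(x,y)$ is strictly increasing in $x$; (ii) $f(x+1,y-1)>f(x,y)$ whenever $x\ge y\ge 2$; (iii) the functions $x\mapsto f(1,x)$ and $x\mapsto f(2,x)$ are strictly convex (downward); (iv) $\phi(x,y)=f(x,y)-f(x-1,y)$ (for $x\ge 2$, $y\ge 1$) is strictly increasing in $x$ and strictly decreasing in $y$. Then for every $T\in\mathbb{T}_{n,d}\setminus\{T_{n,d}^*\}$, $$\mathrm{BID}(T)\le \mathrm{BID}(T_{n,d}^i)=(n-d-1)f(1,n-d+1)+(d-4)f(2,2)+2f(2,n-d+1)+2f(1,2)\qquad(3\le i\le d-1),$$ with equality if and only if $T\cong T_{n,d}^i$ for some $i\in\{3,4,\ldots,d-1\}$.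
   Context: All graphs are finite, simple, undirected and connected; $d(u)$ is the degree of the vertex $u$. For a symmetric real-valued function $f$, the bond incident degree index of a graph $G$ is $\mathrm{BID}(G)=\sum_{uv\in E(G)} f(d(u),d(v))$. $\mathbb{T}_{n,d}$ is the set of trees (up to isomorphism) with $n$ vertices and diameter $d$. Attaching a pendant vertex to a vertex $u$ means adding a new vertex of degree 1 adjacent to $u$. For $2\le i\le d$, $T_{n,d}^i$ is the tree obtained from a path $u_1u_2\ldots u_{d+1}$ by attaching $n-d-1$ pendant vertices to $u_i$. For $i=2$ or $i=d$ (isomorphic trees) it is denoted $T_{n,d}^*$. *)

(* Defs.v *)
From HB Require Import structures.
From mathcomp Require Import all_boot all_order all_algebra.
From mathcomp Require Import reals.

Set Implicit Arguments.
Unset Strict Implicit.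
Unset Printing Implicit Defensive.

Import Order.TTheory GRing.Theory Num.Theory.

Record sgraph := SGraph {
  vertex :> finType;
  edge : rel vertex;
  edge_sym : symmetric edge;
  edge_irr : irreflexive edge }.

Definition deg (G : sgraph) (u : G) : nat := #|[pred v | edge u v]|.

Definition giso (G H : sgraph) : Prop :=
  exists2 h : G -> H, bijective h & forall u v, edge (h u) (h v) = edge u v.

Definition connected (G : sgraph) : Prop :=
  forall u v : G, connect (@edge G) u v.

(* A cycle has length at least 3; the length-2 sequences [:: u; v] with [u]
   adjacent to [v] also satisfy [ucycle]. *)
Definition acyclic (G : sgraph) : Prop :=
  forall c : seq G, ucycle (@edge G) c -> size c < 3.

Definition is_tree (G : sgraph) : Prop := connected G /\ acyclic G.

(* The least length of a walk from [u] to [v]; it is less than [#|G|] when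
   there is one, and the value is [#|G|] when there is none. *)
Definition dist (G : sgraph) (u v : G) : nat :=
  find (fun k => [exists p : k.-tuple G, path (@edge G) u p && (last u p == v)])
       (iota 0 #|G|).

Definition diameter (G : sgraph) : nat := \max_(u : G) \max_(v : G) dist u v.

(* Membership in the class of trees with n vertices and diameter d. *)
Definition in_Tnd (n d : nat) (G : sgraph) : Prop :=
  [/\ is_tree G, #|G| = n & diameter G = d].

Section PathGraph.
Variable m : nat.

Definition path_edge : rel 'I_m :=
  fun a b => ((b : nat) == a.+1) || ((a : nat) == b.+1).

Lemma path_edge_sym : symmetric path_edge.
Proof. by move=> a b; rewrite /path_edge orbC. Qed.

Lemma path_edge_irr : irreflexive path_edge.
Proof. by move=> a; rewrite /path_edge orbb; apply/negbTE; rewrite neq_ltn ltnSn. Qed.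

Definition path_graph : sgraph := SGraph path_edge_sym path_edge_irr.

End PathGraph.

Section AttachPendant.
Variables (G : sgraph) (u : G) (k : nat).

Definition attach_edge : rel (G + 'I_k)%type := fun a b =>
  match a, b with
  | inl x, inl y => edge x y
  | inl x, inr _ => x == u
  | inr _, inl y => y == u
  | inr _, inr _ => false
  end.

Lemma attach_edge_sym : symmetric attach_edge.
Proof. by move=> [x|x] [y|y] //=; rewrite edge_sym. Qed.

Lemma attach_edge_irr : irreflexive attach_edge.
Proof. by move=> [x|x] //=; rewrite edge_irr. Qed.

(* [G] with [k] new pendant vertices, all adjacent to [u]. *)
Definition attach_pendant : sgraph := SGraph attach_edge_sym attach_edge_irr.

End AttachPendant.

(* The path vertex u_i, counted from 1, is the ordinal i - 1. *)
Definition Tndi (n d i : nat) : sgraph :=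
  @attach_pendant (path_graph d.+1) (inord i.-1) (n - d - 1).

Definition Tnd_star (n d : nat) : sgraph := Tndi n d 2.

Local Open Scope ring_scope.

(* [enum_rank u < enum_rank v] selects exactly one of the pairs (u, v), (v, u)
   for each edge; which one does not matter for symmetric [f]. *)
Definition BID (R : realType) (f : R -> R -> R) (G : sgraph) : R :=
  \sum_(u : G) \sum_(v : G | edge u v && (enum_rank u < enum_rank v)%N)
    f (deg u)%:R (deg v)%:R.

Definition strictly_convex_ge1 (R : realType) (g : R -> R) : Prop :=
  forall x y t : R, 1 <= x -> 1 <= y -> x != y -> 0 < t -> t < 1 ->
    g (t * x + (1 - t) * y) < t * g x + (1 - t) * g y.

Definition phi (R : realType) (f : R -> R -> R) (x y : R) : R :=
  f x y - f (x - 1) y.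

(* The coefficient d - 4 is a real number, hence equal to -1 for d = 3. *)
Definition BID_max (R : realType) (f : R -> R -> R) (n d : nat) : R :=
  let N : R := n%:R in let D : R := d%:R in
  (N - D - 1) * f 1 (N - D + 1) + (D - 4) * f 2 2
  + 2 * f 2 (N - D + 1) + 2 * f 1 2.

(* Main.v *)
Require Import Defs.
From mathcomp Require Import all_boot all_order all_algebra.
From mathcomp Require Import reals zify ring lra.
Set Implicit Arguments.
Unset Strict Implicit.
Unset Printing Implicit Defensive.
Import Order.TTheory GRing.Theory Num.Theory.

(** Fix a diametral path u_0, .., u_d of the tree (a spine) and build the tree
    from it by adding the remaining n - d - 1 vertices one at a time, each
    adjacent to exactly one vertex w already present.  If w reaches degree x,
    the index grows by f(1,x) + sum phi(x, deg b), over the older neighbours b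
    of w ([BID2_add]).  The claimed maximum, as a function of the number k of
    off-spine vertices, starts at the index of the path for k = 0, and it
    increases from k to k+1 by
      gain k = f(1,m) + k phi(m,1) + 2 phi(m,2),   m = k + 3,
    which is what a pendant vertex adds when every off-spine vertex is attached
    to one and the same vertex u_i with 2 <= i <= d - 2.  So it is enough to
    compare every step with [gain] ([gain_bound]); phi is positive, increasing
    in its first argument and decreasing in its second one.
    - w = u_i with 2 <= i <= d - 2: then x <= m, and w has two spine neighbours
      of degree at least 2, so the growth is at most [gain k], strictly less if
      x < m.
    - w = u_1 or w = u_{d-1}: only one neighbour is guaranteed to have degree
      at least 2, and the estimate survives because x < m as soon as some
      off-spine vertex is not attached to w ([spread]).
    - w off the spine: x <= k + 1, which is small enough by itself.
    - w = u_0 or w = u_d would give a path longer than the diameter.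

    It remains to start the construction with a [spread] set.  If some
    off-spine vertex is attached to an inner u_i, 2 <= i <= d - 2, that vertex
    is added first ([bounded_mid]).  Otherwise, if u_1 and u_{d-1} both carry an
    off-spine vertex, these two are added first, and
    2 f(1,3) + f(2,3) < f(1,2) + f(1,4) + f(2,4) makes the bound strict at once
    ([bounded_ends]).  Otherwise all off-spine vertices are pendant at the same
    u_1 or u_{d-1} ([hangs_on_second]) and the tree is the excluded one.
    Equality in the last step forces all off-spine vertices to hang on a single
    inner u_i, which determines the tree ([giso_Tndi]). *)

(** * Paths and distances in trees *)

Section Trees.
Variable G : sgraph.
Implicit Types (a b v w : G) (p q : seq G).

Definition avoid v : rel G := fun a b => [&& edge a b, a != v & b != v].

Lemma avoidE v a b : avoid v a b = [&& edge a b, a != v & b != v].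
Proof. by []. Qed.

Lemma avoid_sym v : symmetric (avoid v).
Proof. by move=> a b; rewrite !avoidE edge_sym; congr andb; rewrite andbC. Qed.

Lemma path_avoid v a p :
  path (@edge G) a p -> v \notin a :: p -> connect (avoid v) a (last a p).
Proof.
move=> pe vp; apply/connectP; exists p => //.
elim: p a pe vp => //= b p IH a /andP[eab pe].
rewrite !inE !negb_or => /and3P[va vb vp].
by rewrite avoidE eab eq_sym va eq_sym vb /= IH // inE negb_or vb.
Qed.

(** Otherwise a shortest path from a to b avoiding v, closed up through v,
    would be a cycle.  This is the only place where acyclicity is unfolded. *)
Lemma acyclic_nbr v a b : acyclic G -> edge v a -> edge v b ->
  connect (avoid v) a b -> a = b.
Proof.
move=> acy va vb /connectP[p0 pe0 lp0].
have av : a != v by apply: contraTneq va => ->; rewrite edge_irr.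
case/shortenP: pe0 lp0 => p pe up _ {p0} lp.
have [pE pv] : path (@edge G) a p /\ v \notin p.
  elim: p a pe {up lp va av} => //= c p IH a; rewrite avoidE => /andP[/and3P[-> av cv] /IH[-> vp]].
  by rewrite inE eq_sym negb_or cv vp.
have := acy (v :: a :: p); rewrite /ucycle /= rcons_path va pE -lp edge_sym vb /=.
rewrite inE negb_or eq_sym av pv /=; move: up => /= -> /(_ isT).
by case: p lp {pe pE pv} => //= ->.
Qed.

Lemma uniq_last_nil a q : uniq (a :: q) -> a = last a q -> q = [::].
Proof. by case: q => //= b q /andP[+ _] E; rewrite {1}E mem_last. Qed.

(** Two paths that leave a by different edges and meet again would join two
    neighbours of a outside a. *)
Lemma tree_path_unique a p q : acyclic G ->
  path (@edge G) a p -> uniq (a :: p) -> path (@edge G) a q -> uniq (a :: q) ->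
  last a p = last a q -> p = q.
Proof.
move=> acy; elim: p a q => [|b p IH] a [|c q] //.
- by move=> _ _ _ uq /= E; rewrite (uniq_last_nil uq E).
- by move=> _ up _ _ /= E; rewrite (uniq_last_nil up (esym E)).
move=> /= /andP[ab pb] /andP[ap up] /andP[ac pc] /andP[aq uq] E.
have bc : b = c.
  apply: (acyclic_nbr acy ab ac).
  apply: (connect_trans (path_avoid pb ap)).
  by rewrite (sym_connect_sym (@avoid_sym a)) E; apply: path_avoid.
by rewrite -bc in pc uq E *; congr cons; apply: (IH b q).
Qed.

Lemma dist_le a p : path (@edge G) a p -> dist a (last a p) <= size p.
Proof.
move=> pe; rewrite leqNgt; apply/negP => lt; have := lt => /(before_find 0).
have szp : size p < #|G|.
  by apply: (leq_trans lt); rewrite -[X in _ <= X](size_iota 0) find_size.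
rewrite nth_iota // add0n => /existsP[].
by exists (in_tuple p); rewrite /= pe eqxx.
Qed.

(** The bound on [dist] excludes its default value for unreachable vertices. *)
Lemma dist_geodesic a b : dist a b < #|G| ->
  exists p, [/\ path (@edge G) a p, last a p = b, size p = dist a b
              & uniq (a :: p)].
Proof.
move=> lt; have hs : dist a b < size (iota 0 #|G|) by rewrite size_iota.
have := hs; rewrite -has_find => /(nth_find 0).
rewrite -[find _ _]/(dist a b) nth_iota // add0n.
case/existsP=> p /andP[pe /eqP lp].
case/shortenP: pe lp (size_tuple p) => q qe uq sqp lq sp.
exists q; split=> //; apply/eqP; rewrite eqn_leq -{2}lq dist_le // andbT.
by rewrite -sp uniq_leq_size //; case/andP: uq.
Qed.

Lemma uniq_path_size a p : uniq (a :: p) -> size p < #|G|.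
Proof. by move=> /card_uniqP E; move: (max_card (mem (a :: p))); rewrite E. Qed.

(** A geodesic has the same ends, so it is the given path. *)
Lemma tree_dist a p : acyclic G -> path (@edge G) a p -> uniq (a :: p) ->
  dist a (last a p) = size p.
Proof.
move=> acy pe up.
have [|q [qe lq <- uq]] := @dist_geodesic a (last a p).
  by apply: leq_ltn_trans (dist_le pe) (uniq_path_size up).
by rewrite (tree_path_unique acy qe uq pe up lq).
Qed.

Lemma tree_path_diameter a p : acyclic G -> path (@edge G) a p ->
  uniq (a :: p) -> size p <= diameter G.
Proof.
move=> acy pe up; rewrite -(tree_dist acy pe up).
apply: (@leq_trans (\max_(v : G) dist a v)); first exact: leq_bigmax.
exact: (@leq_bigmax G (fun u => \max_(v : G) dist u v) a).
Qed.

Lemma connect_seq (u : nat -> G) v i k : i <= k ->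
  (forall l, i <= l < k -> edge (u l) (u l.+1)) ->
  (forall l, i <= l <= k -> u l != v) -> connect (avoid v) (u i) (u k).
Proof.
move=> /subnK <-; elim: (k - i) => [|m IH] eu nv; first by rewrite connect0.
apply: (@connect_trans _ _ (u (m + i))).
  by apply: IH => l hl; [apply: eu|apply: nv]; lia.
by apply: connect1; rewrite avoidE eu ?nv //; lia.
Qed.

(** An induced path with d + 1 vertices, indexed by nat so that the neighbours
    of an inner u i are u i.-1 and u i.+1. *)
Definition spine d (u : nat -> G) :=
  {in [pred i | i <= d] &, injective u} /\
  forall i j, i <= d -> j <= d -> edge (u i) (u j) = (j == i.+1) || (i == j.+1).

Lemma spine_rev d u : spine d u -> spine d (fun i => u (d - i)).
Proof.
move=> [ui ue]; split=> [i j|i j] hi hj.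
  rewrite !inE in hi hj; move=> E.
  by have := ui _ _ (leq_subr i d) (leq_subr j d) E; lia.
by rewrite ue; lia.
Qed.

(** A chord u_i u_j would make u_i and u_{j-1} two neighbours of u_j that are
    joined outside u_j. *)
Lemma tree_spine (u : nat -> G) d : acyclic G ->
  {in [pred i | i <= d] &, injective u} ->
  (forall i, i < d -> edge (u i) (u i.+1)) -> spine d u.
Proof.
move=> acy ui ue; split=> // i j.
wlog ij : i j / i <= j => [W|].
  by move=> hi hj; case: (leqP i j) => [|/ltnW] h; [|rewrite edge_sym orbC]; apply: W.
move=> hi hj; case: (eqVneq j i.+1) => [E|nj] /=.
  by rewrite E in hj *; apply: ue.
have -> : (i == j.+1) = false by lia.
apply/negP => eij.
case: (eqVneq i j) eij => [->|nij eij]; first by rewrite edge_irr.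
have ij' : i < j by lia.
suff /ui : u i = u j.-1 by rewrite !inE; lia.
apply: (@acyclic_nbr (u j)) => //; first by rewrite edge_sym.
  by rewrite edge_sym -{2}(ltn_predK ij') ue; lia.
apply: connect_seq => [|l hl|l hl]; [|apply: ue|]; [lia|lia|].
by apply/eqP => /ui; rewrite !inE; lia.
Qed.

Lemma diameter_spine d : acyclic G -> 0 < #|G| -> diameter G = d -> d < #|G| ->
  exists u, spine d u.
Proof.
move=> acy G0 <- {d}; rewrite /diameter.
have [a ->] := @bigop.eq_bigmax G (fun u => \max_(v : G) dist u v) G0.
have [b ->] := @bigop.eq_bigmax G (fun v => dist a v) G0.
move=> /dist_geodesic [p [pe lp <- up]].
exists (nth a (a :: p)); apply: tree_spine => // [i j|i hi].
  by rewrite !inE => hi hj /eqP; rewrite nth_uniq //= => /eqP.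
exact: (pathP a pe).
Qed.

Lemma spine_path d u i k : spine d u -> i + k <= d ->
  path (@edge G) (u i) [seq u j | j <- iota i.+1 k] /\
  uniq [seq u j | j <- iota i k.+1].
Proof.
move=> [ui ue] ik; split.
  elim: k i ik => //= k IH i ik; rewrite ue; [|lia|lia].
  by rewrite eqxx IH //; lia.
rewrite map_inj_in_uniq ?iota_uniq // => x y.
rewrite !mem_iota => hx hy; apply: ui; rewrite inE; lia.
Qed.

Definition seg (u : nat -> G) j : {set G} := [set u i | i : 'I_j.+1].

Lemma segP u j x : reflect (exists2 i, i <= j & x = u i) (x \in seg u j).
Proof.
apply: (iffP imsetP) => -[i]; first by move=> _ ->; exists (i : nat); rewrite // -ltnS.
by move=> hi ->; exists (inord i); rewrite ?inE // inordK.
Qed.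

Lemma mem_seg u j i : i <= j -> u i \in seg u j.
Proof. by move=> ij; apply/segP; exists i. Qed.

Lemma segS u j : seg u j.+1 = u j.+1 |: seg u j.
Proof.
apply/setP=> x; rewrite in_setU1; apply/segP/orP => [[i]|].
  rewrite leq_eqVlt => /predU1P[->|hi] ->; [by left|right].
  by apply: mem_seg; rewrite -ltnS.
by case=> [/eqP ->|/segP[i hi ->]]; [exists j.+1|exists i; rewrite // ltnW].
Qed.

Lemma seg0 u : seg u 0 = [set u 0].
Proof.
apply/setP=> x; rewrite inE; apply/segP/eqP => [[i]|->]; last by exists 0.
by rewrite leqn0 => /eqP ->.
Qed.

Lemma card_seg d u : spine d u -> #|seg u d| = d.+1.
Proof.
move=> [ui _]; rewrite card_in_imset ?card_ord // => i j _ _ /ui E.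
by apply/val_inj/E; rewrite inE -ltnS.
Qed.

Lemma seg_rev d u : seg (fun i => u (d - i)) d = seg u d.
Proof.
apply/setP=> x; apply/segP/segP => -[i hi ->]; exists (d - i); rewrite ?leq_subr //.
by rewrite subKn.
Qed.

(** * Vertices off a spine *)

Section Hanging.
Variables (d : nat) (u : nat -> G).
Hypotheses (treeG : is_tree G) (su : spine d u).
Let P := seg u d.
Let acy : acyclic G := treeG.2.

Lemma spine_connect v i k : v \notin P -> i <= d -> k <= d ->
  connect (avoid v) (u i) (u k).
Proof.
move=> vP; wlog ik : i k / i <= k => [W|] hi hk.
  case: (leqP i k) => [|/ltnW] h; last rewrite (sym_connect_sym (@avoid_sym v)).
    exact: W.
  exact: W.
apply: connect_seq => // l hl; first by case: su => _ ->; lia.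
by apply: contraNneq vP => <-; apply: mem_seg; lia.
Qed.

Lemma spine_nbr_unique v a b : v \notin P -> a \in P -> b \in P ->
  edge v a -> edge v b -> a = b.
Proof.
move=> vP /segP[i hi ->] /segP[k hk ->] ea eb.
by apply: (acyclic_nbr acy ea eb); apply: spine_connect.
Qed.

Hypothesis diamG : diameter G = d.

(** A path outside the spine that ends next to u_i continues along the spine to
    u_d, and the total length cannot exceed the diameter. *)
Lemma path_off_spine i y q : i <= d -> path (@edge G) (last y q) [:: u i] ->
  path (@edge G) y q -> uniq (y :: q) -> all [predC P] (y :: q) ->
  (size q + (d - i)).+1 <= d.
Proof.
move=> hi eqi pq uq qP.
have [|pe up] := @spine_path d u i (d - i) su; first by lia.
rewrite -[X in _ <= X]diamG.
have := @tree_path_diameter y (q ++ [seq u j | j <- iota i (d - i).+1]) acy.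
rewrite size_cat size_map size_iota addnS; apply.
  by rewrite cat_path pq /= pe andbT; move: eqi => /= /andP[].
rewrite -cat_cons cat_uniq uq up andbT andTb.
apply/hasPn => x /mapP[j]; rewrite mem_iota => hj ->.
have uP : u j \in P by apply: mem_seg; lia.
by apply/negP => /(allP qP); rewrite /= uP.
Qed.

Lemma off_nbr_gt0 y i : y \notin P -> i <= d -> edge y (u i) -> 0 < i.
Proof.
move=> yP hi e; have := @path_off_spine i y [::] hi.
by rewrite /= e yP => /(_ isT isT isT isT); lia.
Qed.

Lemma off2_nbr_gt1 z y i : z \notin P -> y \notin P -> i <= d -> edge z y ->
  edge y (u i) -> 1 < i.
Proof.
move=> zP yP hi e e'; have := @path_off_spine i z [:: y] hi.
rewrite /= e e' yP zP inE !andbT; have -> : z != y.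
  by apply: contraTneq e => ->; rewrite edge_irr.
by move=> /(_ isT isT isT isT); lia.
Qed.

(** Provides the next vertex when a proper subset grows to the whole tree. *)
Lemma connected_boundary (S : {set G}) a : a \in S -> S != setT ->
  exists w v, [/\ w \in S, v \notin S & edge w v].
Proof.
move=> aS nS.
have [b bS] : exists b, b \notin S.
  apply/existsP; rewrite -negb_forall; apply: contra nS => /forallP h.
  by apply/eqP/setP => x; rewrite h inE.
have /connectP[p pe] := treeG.1 a b.
elim: p a aS pe => [|c p IH] a aS /=; first by move=> _ E; rewrite E aS in bS.
case/andP=> eac pe lb; case: (boolP (c \in S)) => cS; first exact: (IH c).
by exists a, c.
Qed.

End Hanging.

End Trees.

Local Open Scope ring_scope.

(** * Degrees in an induced subgraph *)

Section Degin.
Variable G : sgraph.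
Implicit Types (S : {set G}) (a b v w : G).

Definition deg_in S a : nat := #|[set b in S | edge a b]|.

Lemma deg_in_setT a : deg_in setT a = deg a.
Proof. by rewrite /deg_in /deg -cardsE; apply: eq_card => b; rewrite !inE. Qed.

Lemma deg_in_add S v a : v \notin S -> deg_in (v |: S) a = (edge a v + deg_in S a)%N.
Proof.
move=> vS; rewrite /deg_in; case: (boolP (edge a v)) => e.
  have -> : [set b in v |: S | edge a b] = v |: [set b in S | edge a b].
    by apply/setP => b; rewrite !inE; case: eqP => // ->; rewrite e.
  by rewrite cardsU1 inE (negbTE vS).
rewrite add0n; apply: eq_card => b; rewrite !inE; case: eqP => // ->.
by rewrite (negbTE e) !andbF.
Qed.

Lemma deg_in_gt0 S a b : b \in S -> edge a b -> (0 < deg_in S a)%N.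
Proof. by move=> bS e; apply/card_gt0P; exists b; rewrite inE bS. Qed.

Lemma deg_in_split S (Q : {set G}) a : Q \subset S ->
  deg_in S a = (deg_in Q a + deg_in (S :\: Q) a)%N.
Proof.
move=> QS; rewrite /deg_in -(cardsID Q); congr (_ + _)%N; apply: eq_card => b; rewrite !inE.
  by case: (boolP (b \in Q)) => [/(subsetP QS) ->|]; rewrite ?andbT ?andbF.
by rewrite andbA.
Qed.

Lemma deg_in_le S a : (deg_in S a <= #|S|)%N.
Proof. by apply: subset_leq_card; apply/subsetP => b; rewrite inE => /andP[]. Qed.

Lemma deg_in_lt S a b : b \in S -> ~~ edge a b -> (deg_in S a < #|S|)%N.
Proof.
move=> bS e; apply: proper_card; apply/properP; split.
  by apply/subsetP => c; rewrite inE => /andP[].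
by exists b => //; rewrite inE bS.
Qed.

(** By induction along the spine: the number of neighbours of u_i among
    u_0, .., u_j has a closed form that holds even when i > j. *)
Lemma deg_in_spine d u i : spine d u -> (i <= d)%N ->
  deg_in (seg u d) (u i : G) = ((0 < i) + (i < d))%N.
Proof.
move=> su hi; suff H j : (j <= d)%N ->
    deg_in (seg u j) (u i) = ((0 < i <= j.+1) + (i < j))%N by rewrite H //; lia.
elim: j => [_|j IH hj].
  rewrite seg0 -[[set u 0%N]]setU0.
  rewrite deg_in_add ?inE // (proj2 su) // /deg_in.
  rewrite (eq_card0 (A := [set b in set0 | edge (u i) b])) => [|b]; last by rewrite !inE.
  lia.
rewrite segS deg_in_add; first by rewrite IH ?(proj2 su) //; lia.
by apply/segP => -[k hk]; move/(proj1 su); rewrite !inE; lia.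
Qed.
End Degin.

(** * Growth of the index when a vertex is added *)

Section Sums.
Variables (R : realType) (f : R -> R -> R).
Hypothesis f_sym : forall x y : R, 1 <= x -> 1 <= y -> f x y = f y x.

Section BID2.
Variable G : sgraph.
Implicit Types (S : {set G}) (a b v w : G).

(** Twice the index of the subgraph induced by S: summing over ordered pairs
    makes the sum symmetric and independent of an enumeration. *)
Definition BID2 S : R :=
  \sum_(a in S) \sum_(b in S | edge a b) f (deg_in S a)%:R (deg_in S b)%:R.

(** Adding a neighbour to w changes only the terms of edges at w, so the change
    is a matrix supported on one row and one column. *)
Lemma star_sum S w (D : G -> G -> R) : w \in S ->
  (forall a b, a \in S -> b \in S -> D a b = D b a) ->
  (forall a b, a \in S -> b \in S -> a != w -> b != w -> D a b = 0) ->
  D w w = 0 ->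
  \sum_(a in S) \sum_(b in S) D a b = 2 * \sum_(b in S) D w b.
Proof.
move=> wS Ds D0 Dw.
rewrite (bigD1 w) //= [in RHS]mulr_natl mulr2n; congr (_ + _).
rewrite [RHS](bigD1 w) //= Dw add0r; apply: eq_bigr => a /andP[aS aw].
rewrite (bigD1 w) //= Ds // big1 ?addr0 // => b /andP[bS bw].
exact: D0.
Qed.

(** The new edge contributes f(1,x), with x the new degree of w, and each old
    edge wb changes from f(x-1, deg b) to f(x, deg b). *)
Lemma BID2_add S v w : v \notin S -> w \in S ->
  (forall b, b \in S -> edge v b = (b == w)) ->
  BID2 (v |: S) = BID2 S + 2 * (f 1 (deg_in S w).+1%:R
    + \sum_(b in S | edge w b) phi f (deg_in S w).+1%:R (deg_in S b)%:R).
Proof.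
move=> vS wS vN.
have vw : edge v w by rewrite vN.
pose F (T : {set G}) a b : R :=
  if edge a b then f (deg_in T a)%:R (deg_in T b)%:R else 0.
have B2E T : BID2 T = \sum_(a in T) \sum_(b in T) F T a b.
  by apply: eq_bigr => a _; rewrite big_mkcondr.
have Fs (T : {set G}) a b : a \in T -> b \in T -> F T a b = F T b a.
  rewrite /F [edge b a]edge_sym; case: ifP => // e aT bT.
  rewrite f_sym // ler1n.
    exact: (deg_in_gt0 bT e).
  by apply: (deg_in_gt0 aT); rewrite edge_sym.
have Fi (T : {set G}) a : F T a a = 0 by rewrite /F edge_irr.
have dv : deg_in (v |: S) v = 1%N.
  rewrite deg_in_add // edge_irr /deg_in -(cards1 w); apply: eq_card => b.
  rewrite !inE; apply/andP/eqP => [[bS]|->]; last by rewrite wS.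
  by rewrite vN // => /eqP.
have dS b : b \in S -> deg_in (v |: S) b = ((b == w) + deg_in S b)%N.
  by move=> bS; rewrite deg_in_add // edge_sym vN.
have SI b : b \in S -> b \in v |: S by move=> bS; rewrite setU1r.
have Fv : \sum_(b in S) F (v |: S) v b = f 1 (deg_in S w).+1%:R.
  rewrite (bigD1 w) //= big1 ?addr0 => [|b /andP[bS bw]].
    by rewrite /F vw dv dS // eqxx.
  by rewrite /F vN // (negbTE bw).
have Fv' : \sum_(a in S) F (v |: S) a v = f 1 (deg_in S w).+1%:R.
  by rewrite -Fv; apply: eq_bigr => a aS; apply: Fs; rewrite ?setU11 ?SI.
have step : \sum_(a in S) \sum_(b in S) (F (v |: S) a b - F S a b)
    = 2 * \sum_(b in S | edge w b) phi f (deg_in S w).+1%:R (deg_in S b)%:R.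
  rewrite (@star_sum S w) //; last by rewrite !Fi subr0.
  - congr (_ * _); rewrite [RHS]big_mkcondr; apply: eq_bigr => b bS /=.
    rewrite /F; case: ifP => // e; last by rewrite subr0.
    have bw : b != w by apply: contraTneq e => ->; rewrite edge_irr.
    rewrite !dS // eqxx (negbTE bw) add0n add1n /phi.
    by rewrite -[X in f (X - 1)]natr1 addrK.
  - by move=> a b aS bS; rewrite (Fs S) // (Fs (v |: S)) //; apply: SI.
  - move=> a b aS bS aw bw; rewrite /F; case: ifP => _; last by rewrite subr0.
    by rewrite !dS // (negbTE aw) (negbTE bw) subrr.
rewrite !B2E big_setU1 //= big_setU1 //= Fi add0r Fv.
rewrite (eq_bigr (fun a => F (v |: S) a v + \sum_(b in S) F (v |: S) a b)); last first.
  by move=> a _; rewrite big_setU1.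
rewrite big_split /= Fv' mulrDr -step.
have -> : \sum_(a in S) \sum_(b in S) (F (v |: S) a b - F S a b) =
    \sum_(a in S) \sum_(b in S) F (v |: S) a b - \sum_(a in S) \sum_(b in S) F S a b.
  by rewrite -sumrB; apply: eq_bigr => a _; rewrite sumrB.
lra.
Qed.
End BID2.

Hypothesis f_incr : forall x x' y : R, 1 <= x -> x < x' -> 1 <= y -> f x y < f x' y.
Hypothesis phi_incr : forall x x' y : R,
  2 <= x -> x < x' -> 1 <= y -> phi f x y < phi f x' y.
Hypothesis phi_decr : forall x y y' : R,
  2 <= x -> 1 <= y -> y < y' -> phi f x y' < phi f x y.

Definition phiN (x y : nat) : R := phi f x%:R y%:R.

Lemma phiN_le x x' y y' : (2 <= x <= x')%N -> (1 <= y' <= y)%N -> phiN x y <= phiN x' y'.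
Proof.
move=> /andP[x2 xx'] /andP[y1 yy']; apply: (@le_trans _ _ (phiN x' y)).
  move: xx'; rewrite leq_eqVlt => /predU1P[->//|xx'].
  by apply/ltW/phi_incr; rewrite ?ltr_nat ?ler_nat ?ler1n //; lia.
move: yy'; rewrite leq_eqVlt => /predU1P[->//|yy'].
by apply/ltW/phi_decr; rewrite ?ltr_nat ?ler_nat ?ler1n //; lia.
Qed.

Lemma phiNE x y : phiN x.+1 y = f x.+1%:R y%:R - f x%:R y%:R.
Proof. by rewrite /phiN /phi -[X in f (X - 1)]natr1 addrK. Qed.

Lemma phiN_gt0 x y : (2 <= x)%N -> (1 <= y)%N -> 0 < phiN x y.
Proof.
case: x => [//|x] x1 y1; rewrite phiNE subr_gt0.
by apply: f_incr; rewrite ?ltr_nat ?ler1n //; lia.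
Qed.

Lemma f1_lt x y : (1 <= x < y)%N -> f 1 x%:R < f 1 y%:R.
Proof.
move=> /andP[x1 xy]; rewrite !(f_sym (x := 1)) ?ler1n //; last by lia.
by apply: f_incr; rewrite ?ltr_nat ?ler1n.
Qed.

(** The growth caused by the (k+1)-st pendant vertex at an inner spine vertex,
    whose degree becomes k + 3: it then has two neighbours of degree 2 and k
    older pendant ones. *)
Definition gain k : R := f 1 k.+3%:R + k%:R * phiN k.+3 1 + 2 * phiN k.+3 2.

(** The claimed maximum, with k vertices off the spine. *)
Definition broom_value d k : R :=
  k%:R * f 1 k.+2%:R + (d%:R - 4) * f 2 2 + 2 * f 2 k.+2%:R + 2 * f 1 2.

(** The differences of f(1,.) and f(2,.) are values of phi because f is
    symmetric. *)
Lemma broom_valueS d k : broom_value d k.+1 = broom_value d k + gain k.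
Proof.
rewrite /broom_value /gain !phiNE !(f_sym (y := 1)) ?(f_sym (y := 2)) ?ler1n ?ler1n //.
by rewrite -(natr1 k); ring.
Qed.

Section Growth.
Variable G : sgraph.
Implicit Types (S : {set G}) (a b v w : G).

Lemma BID2_set1 a : BID2 [set a] = 0.
Proof.
rewrite /BID2 big_set1 big1 // => b /andP[].
by rewrite inE => /eqP ->; rewrite edge_irr.
Qed.

Lemma spine_le d e u : (e <= d)%N -> spine d u -> spine e (u : nat -> G).
Proof.
move=> ed [ui ue]; split=> [i j|i j]; first by rewrite !inE => hi hj; apply: ui; rewrite inE; lia.
by move=> hi hj; apply: ue; lia.
Qed.

Lemma spine_nin d u i j : spine d u -> (j < i <= d)%N -> (u i : G) \notin seg u j.
Proof.
by move=> su hi; apply/segP => -[k hk]; move/(proj1 su); rewrite !inE; lia.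
Qed.

(** The path is itself built vertex by vertex: the vertex following u_i adds
    f(1,2) + phi(2,2) = f(2,2) once i >= 2; before that, u_i or its only
    neighbour is the end u_0, whose degree is smaller. *)
Lemma BID2_seg d u j : spine d u -> (j.+2 <= d)%N ->
  BID2 (seg u j.+2 : {set G}) = 2 * (2 * f 1 2 + j%:R * f 2 2).
Proof.
move=> su; have key i : (i.+1 <= d)%N -> BID2 (seg u i.+1) =
    BID2 (seg u i) + 2 * (f 1 (0 < i).+1%:R + if (0 < i)%N then phiN 2 (1 < i).+1 else 0).
  move=> id; have si := spine_le (ltnW id) su.
  have dg : deg_in (seg u i) (u i) = (0 < i)%N by rewrite deg_in_spine //; lia.
  rewrite segS (@BID2_add _ _ _ (u i)); first last.
  - move=> b /segP[k ki ->]; rewrite (proj2 su) //; last by lia.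
    by apply/idP/eqP => [h|/(proj1 su)]; [congr u|rewrite !inE]; lia.
  - exact: mem_seg.
  - by apply: (spine_nin su); rewrite ltnSn.
  rewrite dg; congr (_ + 2 * (_ + _)); case: ifP => i0; last first.
    have {i0} -> : i = 0%N by lia.
    rewrite big_pred0 // => b; apply/negP => /andP[/segP[k + ->]].
    by rewrite leqn0 => /eqP ->; rewrite edge_irr.
  rewrite (big_pred1 (u i.-1)) => [|b].
    by rewrite /phiN deg_in_spine //; [congr (phi f _ _%:R)|]; lia.
  apply/andP/eqP => [[/segP[k ki ->]]|->]; first by rewrite (proj2 su); [move=> h; congr u|..]; lia.
  by rewrite mem_seg ?(proj2 su); lia.
elim: j => [|j IH] jd.
  rewrite key // key; last by lia.
  rewrite seg0 BID2_set1 /= phiNE (f_sym (x := 2)) ?ler1n //; ring.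
rewrite key // IH /= ?phiNE; last by lia.
by rewrite (f_sym (x := 1)) ?ler1n // -[in RHS]natr1; ring.
Qed.

Lemma BID2_spine d u : spine d u -> (3 <= d)%N ->
  BID2 (seg u d : {set G}) = 2 * broom_value d 0.
Proof.
case: d => [|[|d]] // su d3; rewrite (BID2_seg su) // /broom_value -2!natr1; ring.
Qed.

(** Each neighbour of w known to have degree at least 2 lowers its bound from
    phi(m,1) to phi(m,2); [Q] collects these neighbours. *)
Lemma sum_nbr_le S w (Q : {set G}) m : w \in S ->
  Q \subset [set b in S | edge w b] -> (forall b, b \in Q -> 2 <= deg_in S b)%N ->
  (deg_in S w < m)%N ->
  \sum_(b in S | edge w b) phiN (deg_in S w).+1 (deg_in S b)
    <= (deg_in S w - #|Q|)%:R * phiN m 1 + #|Q|%:R * phiN m 2.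
Proof.
move=> wS QN Q2 dm; set N := [set b in S | edge w b] in QN *.
rewrite (eq_bigl (mem N)) => [|b]; last by rewrite /= inE.
have gt0 b : b \in N -> (0 < deg_in S w)%N /\ (0 < deg_in S b)%N.
  rewrite inE => /andP[bS e]; split; first exact: deg_in_gt0 e.
  by apply: (deg_in_gt0 wS); rewrite edge_sym.
rewrite (big_setID Q) /= (setIidPr QN) addrC; apply: lerD.
  rewrite -(cardsDS QN) mulr_natl -sumr_const; apply: ler_sum => b.
  by rewrite in_setD => /andP[_ /gt0 [? ?]]; apply: phiN_le; lia.
rewrite mulr_natl -sumr_const; apply: ler_sum => b bQ.
have [h1 _] := gt0 b (subsetP QN b bQ); have := Q2 b bQ.
by move=> h2; apply: phiN_le; lia.
Qed.

Lemma sum_nbr_eq S w (Q : {set G}) x :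
  Q \subset [set b in S | edge w b] -> (forall b, b \in Q -> deg_in S b = 2)%N ->
  (forall b, b \in S -> edge w b -> b \notin Q -> deg_in S b = 1)%N ->
  \sum_(b in S | edge w b) phiN x (deg_in S b)
    = (deg_in S w - #|Q|)%:R * phiN x 1 + #|Q|%:R * phiN x 2.
Proof.
move=> QN Q2 Q1; set N := [set b in S | edge w b] in QN *.
rewrite (eq_bigl (mem N)) => [|b]; last by rewrite /= inE.
rewrite (big_setID Q) /= (setIidPr QN) addrC; congr (_ + _).
  rewrite -(cardsDS QN) mulr_natl -sumr_const; apply: eq_bigr => b.
  by rewrite !inE => /and3P[bQ bS e]; rewrite Q1.
by rewrite mulr_natl -sumr_const; apply: eq_bigr => b bQ; rewrite Q2.
Qed.

(** * Comparison of a single step with the gain of a broom *)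

Section Step.
Variables (d : nat) (u : nat -> G).
Hypotheses (d3 : (3 <= d)%N) (su : spine d u).
Let P := seg u d.

Definition hangs_on S i := forall y, y \in S :\: P -> edge (u i) y.

(** Neither u_1 nor u_{d-1} carries all the off-spine vertices of S.  The
    property passes to larger sets, and it keeps the degree of these two
    vertices one below its largest conceivable value. *)
Definition spread S := (exists2 y, y \in S :\: P & ~~ edge (u 1%N) y) /\
                      (exists2 y, y \in S :\: P & ~~ edge (u d.-1) y).

Lemma card_off_add S v : v \notin P -> v \notin S ->
  #|(v |: S) :\: P| = #|S :\: P|.+1.
Proof.
move=> vP vS; rewrite setDUl (_ : [set v] :\: P = [set v]).
  by rewrite cardsU1 in_setD (negbTE vS) andbF.
by apply/setP => x; rewrite in_setD in_set1; case: eqP => [->|]; rewrite ?vP ?andbF.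
Qed.

Lemma deg_in_ge S (Q : {set G}) a : Q \subset S -> (deg_in Q a <= deg_in S a)%N.
Proof. by move=> QS; rewrite (deg_in_split _ QS) leq_addr. Qed.

Lemma deg_in_interior i : (1 <= i <= d.-1)%N -> deg_in P (u i) = 2%N.
Proof. by move=> hi; rewrite deg_in_spine //; lia. Qed.

Lemma mem_spine i : (i <= d)%N -> u i \in P.
Proof. exact: mem_seg. Qed.

Lemma spine_nbr2 i : (1 <= i <= d.-1)%N -> edge (u i) (u i.-1) /\ edge (u i) (u i.+1).
Proof. by move=> hi; split; rewrite (proj2 su); lia. Qed.

Lemma spine_neq i j : (i <= d)%N -> (j <= d)%N -> i != j -> u i != u j.
Proof. by move=> hi hj; apply: contraNneq => /(proj1 su) ->; rewrite ?inE. Qed.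

(** The case in which all the estimates of [gain_bound] are equalities. *)
Lemma gain_exact S v i : P \subset S -> v \notin S -> (2 <= i <= d - 2)%N ->
  (forall y z, y \in v |: S -> y \notin P -> edge y z = (z == u i)) ->
  BID2 (v |: S) = BID2 S + 2 * gain #|S :\: P|.
Proof.
move=> PS vS hi pend; have uS j : (j <= d)%N -> u j \in S.
  by move=> hj; apply: (subsetP PS); apply: mem_spine.
have vP : v \notin P by apply: contra vS; apply: (subsetP PS).
have nP y j : (j <= d)%N -> y \notin P -> y != u j.
  by move=> hj; apply: contraNneq => ->; apply: mem_spine.
rewrite (@BID2_add _ _ _ (u i)) //; [|by apply: uS; lia|]; last first.
  by move=> b bS; apply: pend => //; rewrite setU11.
have sub j : j != i -> (j <= d)%N -> deg_in S (u j) = deg_in P (u j).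
  move=> ji jd; rewrite (deg_in_split _ PS) [X in (_ + X)%N](_ : _ = 0%N) ?addn0 //.
  apply/eqP; rewrite cards_eq0; apply/eqP/setP => y; rewrite !inE.
  apply/negbTE/negP => /andP[/andP[yP yS]]; rewrite edge_sym pend ?setU1r //.
  by apply/negP/spine_neq; lia.
have di : deg_in S (u i) = (2 + #|S :\: P|)%N.
  rewrite (deg_in_split _ PS) deg_in_interior; last by lia.
  congr (_ + _)%N; rewrite /deg_in; apply: eq_card => y; rewrite !inE.
  case: (boolP (y \in P)) => //= yP; case: (boolP (y \in S)) => //= yS.
  by rewrite edge_sym pend ?setU1r ?eqxx.
have [e1 e2] := @spine_nbr2 i ltac:(lia).
congr (_ + 2 * _); rewrite (@sum_nbr_eq _ _ [set u i.-1; u i.+1]).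
- rewrite di cards2 spine_neq; [|lia..].
  by rewrite addKn /gain addrA !add2n.
- by apply/subsetP => b; rewrite !inE => /orP[]/eqP->; rewrite (e1, e2) uS //; lia.
- by move=> b; rewrite !inE => /orP[]/eqP->; rewrite sub ?deg_in_interior; lia.
- move=> b bS eb; rewrite !inE; case: (boolP (b \in P)) => [/segP[j hj E]|bP _].
    move: eb; rewrite E (proj2 su); [|lia|lia].
    by move=> /orP[]/eqP ->; rewrite ?eqxx ?orbT.
  rewrite /deg_in -(cards1 (u i)); apply: eq_card => z.
  rewrite !inE pend ?setU1r //; case: eqP => [->|]; rewrite ?andbF // uS //; lia.
Qed.

(** Induction on the number of off-spine vertices, removing any of them. *)
Lemma BID2_broom S i : P \subset S -> (2 <= i <= d - 2)%N ->
  (forall y z, y \in S -> y \notin P -> edge y z = (z == u i)) ->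
  BID2 S = 2 * broom_value d #|S :\: P|.
Proof.
move=> PS hi; move E : #|S :\: P| => k; elim: k S PS E => [|k IH] S PS E pend.
  suff -> : S = P by rewrite BID2_spine.
  by apply/eqP; rewrite eqEsubset PS -setD_eq0 -cards_eq0 E eqxx.
have /card_gt0P[v] : (0 < #|S :\: P|)%N by rewrite E.
rewrite in_setD => /andP[vP vS].
have PS' : P \subset S :\ v.
  by apply/subsetP => x xP; rewrite !inE (subsetP PS) // andbT; apply: contraNneq vP => <-.
have E' : #|(S :\ v) :\: P| = k.
  apply/eqP; rewrite -eqSS -E (cardsD1 v (S :\: P)) !inE vP vS add1n eqSS.
  by apply/eqP/eq_card => x; rewrite !inE andbCA.
rewrite -(setD1K vS) (@gain_exact _ _ i) ?E' ?setD11 //.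
  rewrite IH // ?broom_valueS ?mulrDr // => y z.
  by rewrite !inE => /andP[_ yS]; apply: pend.
by rewrite setD1K.
Qed.

Hypotheses (treeG : is_tree G) (diamG : diameter G = d).

(** The heart of the argument.  In each case c + 1 is the new degree of w and Q
    is a set of neighbours of degree at least 2: two spine neighbours for an
    inner w, one for w = u_1 or u_{d-1}, none for w off the spine.  The smaller
    Q is, the more room the degree leaves. *)
Lemma gain_bound S v w : P \subset S -> v \notin S -> w \in S ->
  (forall b, b \in S -> edge v b = (b == w)) -> spread (v |: S) ->
  BID2 (v |: S) <= BID2 S + 2 * gain #|S :\: P| /\
  (BID2 (v |: S) = BID2 S + 2 * gain #|S :\: P| ->
   exists2 i, (2 <= i <= d - 2)%N & hangs_on (v |: S) i).
Proof.
move=> PS vS wS vN [[y1 y1S ny1] [y2 y2S ny2]]; set k := #|S :\: P|.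
have vP : v \notin P by apply: contra vS; apply: (subsetP PS).
have vw : edge v w by rewrite vN.
have kS : #|(v |: S) :\: P| = k.+1 by rewrite card_off_add.
have PS' : P \subset v |: S by apply: (subset_trans PS); apply: subsetUr.
have dw : (deg_in S w).+1 = deg_in (v |: S) w by rewrite deg_in_add // edge_sym vw.
have dle : deg_in (v |: S) w = (deg_in P w + deg_in ((v |: S) :\: P) w)%N.
  exact: deg_in_split.
set c := deg_in S w in dw *.
have bound (Q : {set G}) : Q \subset [set b in S | edge w b] ->
    (forall b, b \in Q -> 2 <= deg_in S b)%N -> (c < k.+3)%N ->
    BID2 (v |: S) <= BID2 S + 2 * (f 1 c.+1%:R
      + ((c - #|Q|)%:R * phiN k.+3 1 + #|Q|%:R * phiN k.+3 2)).
  by move=> QN Q2 ck; rewrite (BID2_add vS wS vN) lerD2l ler_pM2l // lerD2l sum_nbr_le.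
clearbody c k.
have strict (Q : {set G}) : Q \subset [set b in S | edge w b] ->
    (forall b, b \in Q -> 2 <= deg_in S b)%N -> (c < k.+2)%N ->
    (c - #|Q| <= k)%N -> (#|Q| <= 2)%N ->
    BID2 (v |: S) < BID2 S + 2 * gain k.
  move=> QN Q2 ck cQ lQ; apply: (le_lt_trans (bound Q QN Q2 (ltnW ck))).
  rewrite ltrD2l ltr_pM2l // /gain -addrA; apply: ltr_leD; first exact: f1_lt.
  by apply: lerD; apply: ler_wpM2r; rewrite ?ler_nat // ltW // phiN_gt0.
have finish : BID2 (v |: S) < BID2 S + 2 * gain k ->
    BID2 (v |: S) <= BID2 S + 2 * gain k /\ (BID2 (v |: S) = BID2 S + 2 * gain k ->
     exists2 i, (2 <= i <= d - 2)%N & hangs_on (v |: S) i).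
  by move=> lt; split=> [|E]; [exact: ltW | rewrite E ltxx in lt].
have SP a : a \in P -> a \in S by apply: (subsetP PS).
have deg2 i : (1 <= i <= d.-1)%N -> (2 <= deg_in S (u i))%N.
  by move=> hi; rewrite -(deg_in_interior hi) deg_in_ge.
case: (boolP (w \in P)) => wP; last first.
  (* w is not its own neighbour, and has at most one neighbour on the spine. *)
  have lw : (deg_in ((v |: S) :\: P) w < k.+1)%N.
    by rewrite -kS (@deg_in_lt _ _ _ w) ?edge_irr // in_setD wP in_setU1 wS orbT.
  have lP : (deg_in P w <= 1)%N.
    apply/card_le1_eqP => a b; rewrite !inE => /andP[aP ea] /andP[bP eb].
    exact: (spine_nbr_unique treeG su wP bP aP eb ea).
  have ck : (c <= k)%N by clear - dw dle lP lw; lia.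
  apply/finish/(strict set0); rewrite ?sub0set ?cards0 ?subn0 ?ltnS ?leqW //.
  by move=> b; rewrite inE.
have [i hi wE] := segP _ _ _ wP; subst w.
(* The end vertices u_0 and u_d are excluded by the diameter. *)
have i0 := off_nbr_gt0 treeG su diamG vP hi vw.
have id : (0 < d - i)%N.
  apply: (off_nbr_gt0 treeG (spine_rev su) diamG); first by rewrite seg_rev; exact: vP.
    exact: leq_subr.
  by rewrite subKn.
have id1 : (1 <= i <= d.-1)%N by clear - i0 id; lia.
have [e1 e2] := spine_nbr2 id1.
rewrite (deg_in_interior id1) in dle.
have dk := deg_in_le ((v |: S) :\: P) (u i).
rewrite kS in dk.
have end_case j y : (1 <= j <= d.-1)%N -> edge (u i) (u j) ->
    y \in (v |: S) :\: P -> ~~ edge (u i) y ->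
    BID2 (v |: S) < BID2 S + 2 * gain k.
  move=> hj eij yS ny; have := deg_in_lt yS ny; rewrite kS => lt.
  have ck : (c <= k.+1)%N by clear - dw dle lt; lia.
  apply: (strict [set u j]); rewrite ?cards1 ?ltnS ?leq_subLR //.
  - by rewrite sub1set inE eij SP // mem_spine //; clear - hj; lia.
  - by move=> b; rewrite inE => /eqP ->; apply: deg2.
case: (eqVneq i 1%N) => [E|i1].
  by apply: finish; apply: (end_case i.+1 y1); rewrite // E //; clear - d3; lia.
case: (eqVneq i d.-1) => [E|i2].
  by apply: finish; apply: (end_case i.-1 y2); rewrite // ?E //; clear - d3; lia.
pose Q := [set u i.-1; u i.+1].
have mid : (2 <= i <= d - 2)%N by clear - id1 i1 i2; lia.
have cQ : #|Q| = 2%N by rewrite cards2 spine_neq //; clear - mid; lia.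
have QN : Q \subset [set b in S | edge (u i) b].
  apply/subsetP => b; rewrite !inE => /orP[]/eqP->.
    by rewrite e1 SP // mem_spine //; clear - mid; lia.
  by rewrite e2 SP // mem_spine //; clear - mid; lia.
have Q2 b : b \in Q -> (2 <= deg_in S b)%N.
  by rewrite !inE => /orP[]/eqP->; apply: deg2; clear - mid; lia.
case: (boolP [forall y in (v |: S) :\: P, edge (u i) y]) => [/forall_inP al|].
  have ck : (c <= k.+2)%N by clear - dw dle dk; lia.
  split; last by move=> _; exists i.
  apply: (le_trans (bound Q QN Q2 ck)).
  rewrite lerD2l ler_pM2l // /gain -addrA cQ; apply: lerD.
    by move: ck; rewrite leq_eqVlt => /predU1P[->//|ck]; apply/ltW/f1_lt.
  by apply: lerD; apply: ler_wpM2r; rewrite ?ler_nat ?leq_subLR // ltW // phiN_gt0.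
rewrite negb_forall_in => /exists_inP[y yS ny].
have := deg_in_lt yS ny; rewrite kS => lt.
have ck : (c <= k.+1)%N by clear - dw dle lt; lia.
by apply/finish/(strict Q); rewrite ?cQ ?ltnS ?leq_subLR // (leq_trans ck).
Qed.

(** * From the spine to the whole tree *)

(** S lies in one component of the tree minus v, for every v outside S; unlike
    plain connectedness inside S, this feeds [acyclic_nbr] directly. *)
Definition stays_connected S :=
  forall v a b, v \notin S -> a \in S -> b \in S -> connect (avoid v) a b.

Lemma spine_stays_connected : stays_connected P.
Proof.
move=> v _ _ vP /segP[i hi ->] /segP[j hj ->].
exact: (spine_connect su).
Qed.

Lemma stays_connected_add S v w : stays_connected S -> w \in S -> edge v w ->
  stays_connected (v |: S).
Proof.
move=> cS wS vw z a b; rewrite in_setU1 negb_or => /andP[zv zS].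
have wz : w != z by apply: contraNneq zS => <-.
suff H x : x \in v |: S -> connect (avoid z) w x.
  move=> /H aS /H; apply: connect_trans.
  by rewrite (sym_connect_sym (@avoid_sym _ z)).
rewrite in_setU1 => /predU1P[->|xS]; last exact: cS.
by apply: connect1; rewrite avoidE edge_sym vw wz eq_sym zv.
Qed.

Lemma stays_connected_nbr S v w b : stays_connected S -> v \notin S -> w \in S ->
  edge v w -> b \in S -> edge v b = (b == w).
Proof.
move=> cS vS wS vw bS; apply/idP/eqP => [vb|->//].
by apply: (acyclic_nbr treeG.2 vb vw); apply: cS.
Qed.

(** The theorem for the subtree induced by S, including the equality case. *)
Definition bounded S := BID2 S <= 2 * broom_value d #|S :\: P| /\
  (BID2 S = 2 * broom_value d #|S :\: P| ->
   exists2 i, (2 <= i <= d - 2)%N & hangs_on S i).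

(** Equality after the step forces equality in the step itself, and the shape
    of the new set comes from [gain_bound] alone. *)
Lemma bounded_add S v w : P \subset S -> stays_connected S -> v \notin S ->
  w \in S -> edge v w -> spread (v |: S) -> bounded S -> bounded (v |: S).
Proof.
move=> PS cS vS wS vw sp [le _].
have vN b : b \in S -> edge v b = (b == w).
  exact: (stays_connected_nbr cS vS wS vw).
have [le' eq'] := gain_bound PS vS wS vN sp.
have vP : v \notin P by apply: contra vS; apply: (subsetP PS).
rewrite /bounded (card_off_add vP vS) broom_valueS mulrDr; split.
  by apply: (le_trans le'); rewrite lerD2r.
move=> E; apply: eq'; apply/eqP; rewrite eq_le le' E.
by rewrite lerD2r.
Qed.

Lemma bounded_setT S : P \subset S -> stays_connected S -> spread S ->
  bounded S -> bounded setT.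
Proof.
move: {2}#|~: S| (erefl #|~: S|) => m.
elim: m S => [|m IH] S mS PS cS sp bS.
  by have /eqP := mS; rewrite cards_eq0 => /eqP E; rewrite -(setCK S) E setC0 in bS.
have nS : S != setT by apply: contra_eqN mS => /eqP ->; rewrite setCT cards0.
have u0S : u 0%N \in S by apply: (subsetP PS); exact: mem_spine.
have [w [v [wS vS wv]]] := connected_boundary treeG u0S nS.
have vw : edge v w by rewrite edge_sym.
have sp' : spread (v |: S).
  by case: sp => -[y1 h1 ?] [y2 h2 ?]; split; [exists y1|exists y2];
    rewrite // setDUl in_setU ?h1 ?h2 orbT.
apply: (IH (v |: S)) => //.
- apply/eqP; rewrite -eqSS -mS (cardsD1 v (~: S)) !inE vS add1n eqSS.
  by apply/eqP/eq_card => x; rewrite !inE negb_or.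
- exact: (subset_trans PS (subsetUr _ _)).
- exact: (stays_connected_add cS wS vw).
- exact: (bounded_add PS cS vS wS vw).
Qed.

Lemma off_nbr_neq y i j : y \notin P -> (i <= d)%N -> (j <= d)%N -> i != j ->
  edge y (u i) -> ~~ edge (u j) y.
Proof.
move=> yP hi hj ij e; rewrite edge_sym; apply: contra ij => e'.
by apply/eqP/(proj1 su)/(spine_nbr_unique treeG su yP _ _ e e'); rewrite ?inE ?mem_spine.
Qed.

Lemma mem_off_add y S : y \notin P -> y \in (y |: S) :\: P.
Proof. by move=> yP; rewrite in_setD yP setU11. Qed.

Lemma bounded_mid y i : y \notin P -> (2 <= i <= d - 2)%N -> edge y (u i) ->
  bounded setT.
Proof.
move=> yP hi e; have iP : u i \in P by apply: mem_spine; lia.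
have sp : spread (y |: P).
  by split; exists y; rewrite ?mem_off_add // (off_nbr_neq yP _ _ _ e) //; lia.
apply: (bounded_setT (subsetUr [set y] P)) => //.
  exact: stays_connected_add spine_stays_connected iP e.
apply: (bounded_add _ spine_stays_connected yP iP e) => //.
split; first by rewrite setDv cards0 BID2_spine.
by move=> _; exists i => // z; rewrite setDv inE.
Qed.

(** The two sides are bounds for a path with one pendant vertex at each of u_1
    and u_{d-1}, and the value for two pendant vertices at one inner vertex. *)
Lemma double_broom_lt :
  2 * broom_value d 0 + 2 * (2 * (f 1 3%:R + (phiN 3 1 + phiN 3 2)))
    < 2 * broom_value d 2.
Proof.
rewrite !broom_valueS /gain.
have h1 : phiN 3 1 <= phiN 4 1 by apply: phiN_le.
have h2 := @phiN_gt0 4 2 isT isT.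
have h3 := @phiN_gt0 4 1 isT isT.
have := phiNE 3 1; rewrite !(f_sym (y := 1)) ?ler1n // => h4.
lra.
Qed.

(** Meant for a first pendant vertex at u_1 or u_{d-1}, where one of the two
    older neighbours is an end of the spine and only the other one, u_j, has
    degree at least 2. *)
Lemma BID2_add_end S v i j : P \subset S -> stays_connected S -> v \notin S ->
  (1 <= i <= d.-1)%N -> (1 <= j <= d.-1)%N -> edge (u i) (u j) ->
  edge v (u i) -> deg_in S (u i) = 2%N ->
  BID2 (v |: S) <= BID2 S + 2 * (f 1 3%:R + (phiN 3 1 + phiN 3 2)).
Proof.
move=> PS cS vS hi hj ij vi dg.
have SP l : (l <= d)%N -> u l \in S by move=> hl; apply: (subsetP PS); apply: mem_spine.
have iS : u i \in S by apply: SP; lia.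
have jS : u j \in S by apply: SP; lia.
rewrite (@BID2_add _ _ _ (u i)) // => [|b bS]; last exact: (stays_connected_nbr cS vS iS vi bS).
rewrite lerD2l ler_pM2l // dg lerD2l.
have := @sum_nbr_le S (u i) [set u j] 3 iS; rewrite dg cards1 !mul1r; apply=> //.
  by rewrite sub1set inE jS.
by move=> b; rewrite inE => /eqP ->; rewrite -(deg_in_interior hj) deg_in_ge.
Qed.

Lemma bounded_ends y1 y2 : y1 \notin P -> y2 \notin P ->
  edge y1 (u 1%N) -> edge y2 (u d.-1) -> bounded setT.
Proof.
have h1 : (1 <= 1 <= d.-1)%N by lia.
have h2 : (1 <= 2 <= d.-1)%N by lia.
have h3 : (1 <= d.-1 <= d.-1)%N by lia.
have h4 : (1 <= d.-2 <= d.-1)%N by lia.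
have [l1 ld n1d] : [/\ 1 <= d, d.-1 <= d & 1 != d.-1]%N by split; lia.
move=> y1P y2P e1 e2.
have n1 : ~~ edge (u d.-1) y1 by apply: (off_nbr_neq y1P _ _ _ e1).
have n2 : ~~ edge (u 1%N) y2 by apply: (off_nbr_neq y2P _ _ _ e2); rewrite // eq_sym.
have y21 : y2 != y1 by apply: contraNneq n1 => <-; rewrite edge_sym.
pose S := y1 |: P.
have u1P : u 1%N \in P by apply: mem_spine.
have udP : u d.-1 \in P by apply: mem_spine.
have PS : P \subset S := subsetUr _ _.
have cS : stays_connected S := stays_connected_add spine_stays_connected u1P e1.
have y2S : y2 \notin S by rewrite in_setU1 negb_or y21.
have b1 : BID2 S <= BID2 P + 2 * (f 1 3%:R + (phiN 3 1 + phiN 3 2)).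
  apply: (BID2_add_end _ spine_stays_connected y1P h1 h2 _ e1) => //.
  - exact: (spine_nbr2 h1).2.
  - exact: deg_in_interior.
have b2 : BID2 (y2 |: S) <= BID2 S + 2 * (f 1 3%:R + (phiN 3 1 + phiN 3 2)).
  apply: (BID2_add_end PS cS y2S h3 h4 _ e2) => //.
  - exact: (spine_nbr2 h3).1.
  - by rewrite deg_in_add // (negbTE n1) deg_in_interior.
have lt : BID2 (y2 |: S) < 2 * broom_value d #|(y2 |: S) :\: P|.
  rewrite card_off_add // card_off_add // setDv cards0.
  apply: le_lt_trans (double_broom_lt); rewrite -(BID2_spine su d3).
  move: b1 b2; rewrite -/P; lra.
apply: (@bounded_setT (y2 |: S)).
- exact: subset_trans PS (subsetUr _ _).
- by apply: (stays_connected_add cS _ e2); rewrite setU1r.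
- split; [exists y2|exists y1]; rewrite // in_setD ?y1P ?y2P ?setU11 //.
  by rewrite setU1r // setU11.
- by split=> [|E]; [exact: ltW | rewrite E ltxx in lt].
Qed.

End Step.
End Growth.
End Sums.

(** * Recognizing the brooms *)

Section Shape.
Variables (G : sgraph) (d : nat) (u : nat -> G).
Hypotheses (treeG : is_tree G) (d3 : (3 <= d)%N) (su : spine d u).
Let P := seg u d.

(** A further neighbour of y would be joined to u_i outside y, either along the
    spine or by its own edge to u_i. *)
Lemma hangs_on_pendant i y z : hangs_on d u setT i -> (i <= d)%N -> y \notin P ->
  edge y z = (z == u i).
Proof.
move=> hang hi yP.
have off x : x \notin P -> edge (u i) x by move=> xP; apply: hang; rewrite !inE xP.
have yi : edge y (u i) by rewrite edge_sym off.
apply/idP/eqP => [yz|->//]; apply: (acyclic_nbr treeG.2 yz yi).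
case: (boolP (z \in P)) => [/segP[j hj ->]|zP]; first exact: (spine_connect su).
apply: connect1; rewrite avoidE edge_sym off //=.
have nyz : z != y by apply: contraTneq yz => ->; rewrite edge_irr.
by rewrite nyz; apply: contraNneq yP => <-; apply: mem_seg.
Qed.

(** The spine is indexed from 0, hence the shift of i. *)
Lemma giso_Tndi n i : #|G| = n -> (1 <= i <= d.-1)%N -> hangs_on d u setT i ->
  giso G (Tndi n d i.+1).
Proof.
move=> cG hi hang; have id : (i <= d)%N by lia.
have pend y z := @hangs_on_pendant i y z hang id.
have cP : #|~: P| = (n - d - 1)%N.
  by have := cardsC P; rewrite (card_seg su) cG; lia.
have offP (j : 'I_(n - d - 1)) : enum_val (cast_ord (esym cP) j) \notin P.
  by have := enum_valP (cast_ord (esym cP) j); rewrite in_setC.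
pose h (x : Tndi n d i.+1) : G := match x with
  | inl j => u (j : nat)
  | inr j => enum_val (cast_ord (esym cP) j) end.
have lo (j : 'I_d.+1) : (j <= d)%N by rewrite -ltnS.
have hinj : injective h.
  move=> [j|j] [k|k] /= E.
  - by have -> : j = k by apply: val_inj; apply: (proj1 su _ _ (lo j) (lo k) E).
  - by have := offP k; rewrite -E mem_seg.
  - by have := offP j; rewrite E mem_seg.
  - by move/enum_val_inj/cast_ord_inj: E => ->.
have hbij : bijective h.
  apply: (inj_card_bij hinj).
  have := cardsC P; rewrite (card_seg su) cP cG => E.
  by rewrite [#|Tndi _ _ _|]card_sum !card_ord E -cG.
have hedge x y : edge (h x) (h y) = edge x y.
  case: x y => [j|j] [k|k] /=.
  - by rewrite (proj2 su).
  - rewrite edge_sym pend //; apply/eqP/eqP => [/(proj1 su) E|->].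
      by apply: val_inj; rewrite /= inordK ?ltnS // E ?inE.
    by rewrite inordK.
  - rewrite pend //; apply/eqP/eqP => [/(proj1 su) E|->].
      by apply: val_inj; rewrite /= inordK ?ltnS // E ?inE.
    by rewrite inordK.
  - rewrite pend //; apply/negbTE.
    by apply: contraNneq (offP k) => ->; apply: mem_seg.
have [g hK gK] := hbij; exists g; first by exists h.
by move=> a b; rewrite -hedge !gK.
Qed.

Hypothesis diamG : diameter G = d.

(** Consider the spine with the neighbours of u_1.  A vertex z adjacent to
    this set but outside it is adjacent either to a spine vertex other than u_1, or
    to an off-spine neighbour y of u_1; in the second case z, y, u_1, .., u_d is
    longer than the diameter. *)
Lemma hangs_on_second :
  (forall y i, y \notin P -> (2 <= i <= d.-1)%N -> ~~ edge y (u i)) ->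
  hangs_on d u setT 1.
Proof.
move=> no y; rewrite in_setD => /andP[yP _]; apply/negPn/negP => ny.
pose S := P :|: [set x | edge (u 1%N) x].
have nbr z i : z \notin P -> (i <= d)%N -> edge z (u i) -> i = 1%N.
  move=> zP hi e; have i0 := off_nbr_gt0 treeG su diamG zP hi e.
  have id : (0 < d - i)%N.
    apply: (off_nbr_gt0 treeG (spine_rev su) diamG _ (leq_subr i d)).
      by rewrite seg_rev; exact: zP.
    by rewrite subKn.
  have := no z i zP; rewrite e; case: (eqVneq i 1%N) => // i1.
  have hi' : (2 <= i <= d.-1)%N by clear - i0 id i1; lia.
  by move/(_ hi').
have yS : y \notin S by rewrite in_setU negb_or inE yP.
have nS : S != setT by apply: contraNneq yS => ->; rewrite inE.
have u0S : u 0%N \in S by rewrite in_setU mem_seg.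
have [w [z [wS zS wz]]] := connected_boundary treeG u0S nS.
move: zS; rewrite in_setU negb_or [z \in [set _ | _]]inE => /andP[zP nz].
case: (boolP (w \in P)) => wP.
  have [i hi E] := segP _ _ _ wP.
  have := nbr z i zP hi; rewrite -E edge_sym => /(_ wz) i1.
  by move: wz nz; rewrite E i1 => ->.
have uw : edge w (u 1%N).
  by move: wS; rewrite in_setU (negbTE wP) inE edge_sym.
by have := off2_nbr_gt1 treeG su diamG zP wP (ltnW (ltnW d3)) _ uw; rewrite edge_sym => /(_ wz).
Qed.
End Shape.

(** * The index of a graph and of an isomorphic copy *)

Section Invariance.
Variables (R : realType) (f : R -> R -> R).
Hypothesis f_sym : forall x y : R, 1 <= x -> 1 <= y -> f x y = f y x.

Lemma BID_BID2 (G : sgraph) : 2 * BID f G = BID2 f (setT : {set G}).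
Proof.
pose F a b := f (deg (a : G))%:R (deg (b : G))%:R.
have E : BID2 f (setT : {set G}) = \sum_(a : G) \sum_(b | edge a b) F a b.
  rewrite /BID2; under eq_bigl do rewrite inE; apply: eq_bigr => a _.
  under eq_bigl do rewrite inE; apply: eq_bigr => b _.
  by rewrite !deg_in_setT.
have Fs a b : edge a b -> F a b = F b a.
  move=> e; rewrite /F f_sym // ler1n /deg; apply/card_gt0P.
    by exists b.
  by exists a; rewrite !inE edge_sym.
rewrite E mulr_natl mulr2n.
rewrite [RHS](eq_bigr (fun a => \sum_(b | edge a b && (enum_rank a < enum_rank b)%N) F a b +
   \sum_(b | edge a b && (enum_rank b < enum_rank a)%N) F a b)); last first.
  move=> a _; rewrite (bigID (fun b => enum_rank a < enum_rank b)%N) /=; congr (_ + _).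
  apply: eq_bigl => b; case: (boolP (edge a b)) => //= e.
  rewrite -leqNgt leq_eqVlt; case: eqP => // /val_inj/enum_rank_inj E'.
  by rewrite E' edge_irr in e.
rewrite big_split; congr (_ + _) => /=.
rewrite (exchange_big_dep predT) //=; apply: eq_bigr => b _.
by apply: eq_big => [a|a /andP[e _]]; [rewrite edge_sym|apply: Fs].
Qed.

Lemma giso_deg (G H : sgraph) (h : G -> H) a : bijective h ->
  (forall x y, edge (h x) (h y) = edge x y) -> deg (h a) = deg a.
Proof.
move=> hb he; rewrite /deg -!sum1_card (reindex h) /=; last exact: onW_bij.
by apply: eq_bigl => b; rewrite !inE he.
Qed.

Lemma giso_BID (G H : sgraph) : giso G H -> BID f G = BID f H.
Proof.
move=> [h hb he]; have two : (2 : R) != 0 by rewrite pnatr_eq0.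
apply: (mulfI two); rewrite !BID_BID2 /BID2.
under [RHS]eq_bigl do rewrite inE.
rewrite [RHS](reindex h) /=; last exact: onW_bij.
under [LHS]eq_bigl do rewrite inE.
apply: eq_bigr => a _; rewrite [RHS](reindex h) /=; last exact: onW_bij.
apply: eq_big => b; first by rewrite !inE he.
by move=> _; rewrite !deg_in_setT !(giso_deg _ hb he).
Qed.
End Invariance.

(** * The extremal trees and the theorem *)

Section Tnd.
Variables (n d i : nat).
Let T := Tndi n d i.
(** Beyond d the value is the [inord] default, outside the range of a spine. *)
Definition Tndi_spine (j : nat) : T := inl (inord j).

Lemma Tndi_spineP : spine d Tndi_spine.
Proof.
split=> [j k|j k hj hk]; last by rewrite /= /path_edge !inordK.
by rewrite !inE => hj hk [/(congr1 val)]; rewrite /= !inordK.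
Qed.

Lemma Tndi_pendant y z : y \notin seg Tndi_spine d ->
  edge y z = (z == Tndi_spine i.-1).
Proof.
case: y => [j|j].
  case/negP; apply/segP; exists (j : nat); first by rewrite -ltnS.
  by rewrite /Tndi_spine inord_val.
by case: z.
Qed.
End Tnd.

Lemma BID_maxE (R : realType) (f : R -> R -> R) n d : (d.+1 <= n)%N ->
  BID_max f n d = broom_value f d (n - d - 1).
Proof.
move=> dn; rewrite /BID_max /broom_value.
have E1 : n%:R - d%:R - 1 = (n - d - 1)%:R :> R by rewrite !natrB //; lia.
have E2 : n%:R - d%:R + 1 = (n - d - 1).+2%:R :> R.
  by rewrite -2!natr1 -E1; ring.
by rewrite E1 E2.
Qed.

Theorem theorem2p7 (R : realType) (n d : nat) (f : R -> R -> R)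
  (hd : (3 <= d)%N) (hn : (d + 3 <= n)%N)
  (f_sym : forall x y : R, 1 <= x -> 1 <= y -> f x y = f y x)
  (f_incr : forall x x' y : R, 1 <= x -> x < x' -> 1 <= y -> f x y < f x' y)
  (f_shift : forall x y : R, y <= x -> 2 <= y -> f x y < f (x + 1) (y - 1))
  (f1_convex : strictly_convex_ge1 (fun x => f 1 x))
  (f2_convex : strictly_convex_ge1 (fun x => f 2 x))
  (phi_incr : forall x x' y : R,
    2 <= x -> x < x' -> 1 <= y -> phi f x y < phi f x' y)
  (phi_decr : forall x y y' : R,
    2 <= x -> 1 <= y -> y < y' -> phi f x y' < phi f x y) :
  (forall i : nat, (3 <= i <= d - 1)%N -> BID f (Tndi n d i) = BID_max f n d) /\
  (forall T : sgraph, in_Tnd n d T -> ~ giso T (Tnd_star n d) ->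
    BID f T <= BID_max f n d /\
    (BID f T = BID_max f n d <->
     exists2 i : nat, (3 <= i <= d - 1)%N & giso T (Tndi n d i))).
Proof.
have two : (2 : R) != 0 by rewrite pnatr_eq0.
have value i : (3 <= i <= d - 1)%N -> BID f (Tndi n d i) = BID_max f n d.
  move=> hi; apply: (mulfI two); rewrite BID_BID2 // BID_maxE; last by lia.
  have su := Tndi_spineP n d i.
  rewrite (BID2_broom f_sym hd su (i := i.-1)) //; last 2 first.
  - by lia.
  - by move=> y z _; apply: Tndi_pendant.
  rewrite setTD; congr (_ * broom_value _ _ _).
  have := cardsC (seg (@Tndi_spine n d i) d); rewrite (card_seg su).
  by rewrite card_sum !card_ord; lia.
split=> // T [treeT cT diamT] nstar.
have [u su] : exists u, spine d (u : nat -> T).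
  by apply: diameter_spine diamT _; rewrite ?cT; [exact: treeT.2|lia|lia].
pose P := seg u d.
have cP : #|setT :\: P| = (n - d - 1)%N.
  by rewrite setTD; have := cardsC P; rewrite (card_seg su) cT; lia.
have offP y : y \notin P -> y \in setT :\: P by rewrite setTD in_setC.
suff [le eqv] : bounded f d u (setT : {set T}).
  rewrite cP -BID_maxE -?BID_BID2 // in le eqv; last by lia.
  split; first by rewrite ler_pM2l in le.
  split=> [E|[i hi gi]]; last by rewrite (giso_BID f_sym gi) value.
  have [|i hi hang] := eqv; first by rewrite E.
  by exists i.+1; [lia|apply: (giso_Tndi treeT hd su cT _ hang); lia].
case: (boolP [exists y, [exists i : 'I_d, [&& y \notin P, (2 <= i <= d - 2)%N & edge y (u i)]]]).
  case/existsP=> y /existsP[i /and3P[yP hi e]].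
  exact: (bounded_mid f_sym f_incr phi_incr phi_decr hd su treeT diamT yP hi e).
move=> nomid.
have mid y i : y \notin P -> (2 <= i <= d - 2)%N -> ~~ edge y (u i).
  move=> yP hi; apply: contra nomid => e; apply/existsP; exists y.
  have id : (i < d)%N by lia.
  by apply/existsP; exists (Ordinal id); rewrite yP hi.
have su' := spine_rev su.
case: (boolP [exists y, (y \notin P) && edge y (u 1%N)]) => [/existsP[y1 /andP[y1P e1]]|no1].
  case: (boolP [exists y, (y \notin P) && edge y (u d.-1)]) => [/existsP[y2 /andP[y2P e2]]|no2].
    exact: (bounded_ends f_sym f_incr phi_incr phi_decr hd su treeT diamT y1P y2P e1 e2).
  case: nstar; apply: (giso_Tndi treeT hd su cT) => //; first by lia.
  apply: hangs_on_second => // y i yP hi.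
  have [E|id] := eqVneq i d.-1; last by apply: mid => //; lia.
  by rewrite E; apply: contra no2 => e; apply/existsP; exists y; rewrite yP.
case: nstar; apply: (giso_Tndi treeT hd su' cT) => //; first by lia.
apply: hangs_on_second => // y i; rewrite seg_rev => yP hi.
have [E|id] := eqVneq i d.-1; last by apply: mid => //; lia.
rewrite E (_ : d - d.-1 = 1)%N; last by lia.
by apply: contra no1 => e; apply/existsP; exists y; rewrite yP.
Qed.
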